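(* For every metric space $X$, $\mathrm{ad}(X)\ge\dim^{large}_{scale}(X)$ and $\dim^{coa}_{rse}(X)\ge\dim^{large}_{scale}(X)$, where $\mathrm{ad}$ is the minor asymptotic dimension, $\dim^{coa}_{rse}$ the coarse dimension, and $\dim^{large}_{scale}$ the large scale dimension.
   Context: Let $(X,d)$ be a metric space. For points, $x_k\to\infty$ means $d(x_k,x_0)\to\infty$ for some (hence every) $x_0\in X$. A function $f:X\to[0,\infty]$ is coarsely proper if $f(x_k)\to\infty$ whenever $x_k\to\infty$. Families of subsets of $X$ need not cover $X$. For a family $\mathcal U$ of subsets of $X$, $L_{\mathcal U}(x)=\sup_{U\in\mathcal U}\mathrm{dist}(x,X\setminus U)\in[0,\infty]$, with $\mathrm{dist}(x,\emptyset)=\infty$ and the supremum over the empty family equal to $0$. The Lebesgue number of $\mathcal U$ is $L(\mathcal U,X)=\inf_{x\in X}L_{\mathcal U}(x)$. The family $\mathcal U$ is coarse if $L_{\mathcal U}$ is coarsely proper. The multiplicity of $\mathcal U$ is the supremum over $x\in X$ of the number of elements of $\mathcal U$ containing $x$. $\mathcal V$ refines $\mathcal U$ if each element of $\mathcal V$ is contained in some element of $\mathcal U$; a coarse refinement is a refinement that is a coarse family. For $A\subset X$ and a family $\mathcal U$ in $X$, $L^n(\mathcal U,A)$ is the supremum of all $t\in[0,\infty]$ such that the family $\mathcal U|_A=\{U\cap A\}_{U\in\mathcal U}$ in the metric space $A$ has a refinement (by subsets of $A$) of multiplicity at most $n+1$ and Lebesgue number (computed in the metric space $A$) at least $t$.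 Coarse dimension $\dim^{coa}_{rse}(X)$: the smallest integer $n\ge-1$ such that every finite coarse family in $X$ has a coarse refinement of multiplicity at most $n+1$. Minor asymptotic dimension $\mathrm{ad}(X)$: the smallest integer $n\ge0$ such that $L^n(\mathcal U_k,X)\to\infty$ for every sequence of finite covers $\mathcal U_k$ of $X$ with $L(\mathcal U_k,X)\to\infty$. Large scale dimension $\dim^{large}_{scale}(X)$: the smallest integer $n\ge-1$ such that for every finite coarse family $\mathcal U$ in $X$ the function $A\mapsto L^n(\mathcal U,A)$ is coarsely proper on nonempty bounded subsets of $X$, i.e. $L^n(\mathcal U,A_k)\to\infty$ whenever $A_k$ are nonempty bounded subsets with $\mathrm{dist}(x_0,A_k)\to\infty$. In particular it is $-1$ if $X$ is bounded. Each dimension is $\infty$ if no such integer exists. *)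

(* Defs.v *)
From mathcomp Require Import all_boot all_order all_algebra.
From mathcomp Require Import all_classical all_reals all_analysis.

Set Implicit Arguments.
Unset Strict Implicit.
Unset Printing Implicit Defensive.

Import Order.TTheory GRing.Theory Num.Theory.
Import numFieldNormedType.Exports.

Local Open Scope classical_set_scope.
Local Open Scope ring_scope.
Local Open Scope ereal_scope.

(* Families of subsets of X are sets of subsets, [set (set X)], and need not   *)
(* cover X. A subset A of X is viewed as a metric space for the restricted     *)
(* distance: the notions with an argument A are computed in A, the ambient     *)
(* case being A = setT.                                                        *)

(* Supremum in [0, +oo] of a set of nonnegative extended reals, 0 on set0.     *)
Definition sup0 (R : realType) (S : set (\bar R)) : \bar R :=
  ereal_sup (0 |` S).

Section CoarseNotions.
Context {R : realType} {X : metricType R}.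
Implicit Types (A U : set X) (F G : set (set X)) (n : int).

(* The infimum is +oo when A is empty.                                         *)
Definition dist_set (x : X) A : \bar R := ereal_inf [set (mdist x y)%:E | y in A].

Definition to_infty (x : nat -> X) : Prop :=
  exists x0 : X, (mdist (x k) x0)%:E @[k --> \oo] --> +oo.

Definition coarsely_proper (f : X -> \bar R) : Prop :=
  forall x : nat -> X, to_infty x -> f (x k) @[k --> \oo] --> +oo.

Definition metric_bounded A : Prop :=
  exists M : R, forall x y, A x -> A y -> (mdist x y <= M)%R.

Definition covers F : Prop := \bigcup_(U in F) U = setT.

Definition refines G F : Prop :=
  forall V, G V -> exists2 U, F U & V `<=` U.

Definition lebesgue_fun A F (x : X) : \bar R :=
  sup0 [set dist_set x (A `\` U) | U in F].

Definition lebesgue_number A F : \bar R :=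
  ereal_inf [set lebesgue_fun A F x | x in A].

Definition coarse F : Prop := coarsely_proper (lebesgue_fun setT F).

(* [counting] is the number of elements, +oo for an infinite set.              *)
Definition multiplicity A F : \bar R :=
  sup0 [set counting [set U | F U /\ U x] | x in A].

Definition restrict_family F A : set (set X) := [set U `&` A | U in F].

(* L^n(F, A). The members of a refinement of F|_A are subsets of A.            *)
Definition lebesgue_dim n F A : \bar R :=
  sup0 [set t | 0 <= t /\ exists G,
    [/\ refines G (restrict_family F A),
        multiplicity A G <= (n + 1)%:~R%:E
      & t <= lebesgue_number A G]].

End CoarseNotions.

(* The smallest integer n >= n0 with P n: a nonempty set of integers bounded   *)
(* below attains its infimum, and the infimum of set0 is +oo.                  *)
Definition smallest_int (R : realType) (n0 : int) (P : int -> Prop) : \bar R :=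
  ereal_inf [set n%:~R%:E | n in [set n : int | (n0 <= n)%R /\ P n]].

Section Dimensions.
Context {R : realType} (X : metricType R).

Definition coarse_dim : \bar R :=
  smallest_int R (-1) (fun n =>
    forall F : set (set X), finite_set F -> coarse F ->
    exists G, [/\ refines G F, coarse G
                & multiplicity setT G <= (n + 1)%:~R%:E]).

Definition minor_asdim : \bar R :=
  smallest_int R 0 (fun n =>
    forall F : nat -> set (set X),
      (forall k, finite_set (F k) /\ covers (F k)) ->
      lebesgue_number setT (F k) @[k --> \oo] --> +oo ->
      lebesgue_dim n (F k) setT @[k --> \oo] --> +oo).

Definition large_scale_dim : \bar R :=
  smallest_int R (-1) (fun n =>
    forall F : set (set X), finite_set F -> coarse F ->
    forall (A : nat -> set X) (x0 : X),
      (forall k, A k !=set0 /\ metric_bounded (A k)) ->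
      dist_set x0 (A k) @[k --> \oo] --> +oo ->
      lebesgue_dim n F (A k) @[k --> \oo] --> +oo).

End Dimensions.

(* Main.v *)
Require Import Defs.
From mathcomp Require Import all_boot all_order all_algebra.
From mathcomp Require Import all_classical all_reals all_analysis.

Local Open Scope ereal_scope.

(** Both inequalities rest on two remarks. A coarsely proper function is
    uniformly large far away from a base point ([coarsely_proper_ge]), hence on
    [A k] once the sets [A k] escape to infinity. And a family of multiplicity
    at most [n + 1] in a space, cut down to a subset [A], keeps its multiplicity
    bound while its Lebesgue function, now computed in [A], does not decrease
    ([le_lebesgue_dim]).

    For the coarse dimension, a coarse refinement of [F], restricted to [A k],
    refines the restriction of [F], and its Lebesgue number in [A k] tends to
    infinity since the refinement is coarse.

    For the minor asymptotic dimension, a coarse family [F] need not cover the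
    space, so the traces of [F] on the sets [A k] are extended to families of
    the whole space by adding to each member of [F] the complement of [A k]
    ([fill F (A k)]). A point near the base point is far from [A k], and a point
    far from the base point is well inside a member of [F]; so the Lebesgue
    numbers of these families tend to infinity ([fill_lebesgue_near]), and the
    families are covers from some index on. Restricting a refinement back to
    [A k], where [F] and its extension have the same trace, concludes. *)

Local Open Scope classical_set_scope.
Import Order.TTheory GRing.Theory Num.Theory.

Set Implicit Arguments.
Unset Strict Implicit.
Unset Printing Implicit Defensive.

Section Sup0.
Context {R : realType}.
Implicit Types S T : set (\bar R).

Lemma sup0_ge0 S : 0 <= Defs.sup0 S.
Proof. by apply: ereal_sup_ubound; left. Qed.

Lemma sup0_ub {S} {s : \bar R} : S s -> s <= Defs.sup0 S.
Proof. by move=> Ss; apply: ereal_sup_ubound; right. Qed.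

Lemma ge_sup0 S (b : \bar R) :
  0 <= b -> (forall s, S s -> s <= b) -> Defs.sup0 S <= b.
Proof. by move=> b0 Sb; apply: ge_ereal_sup => s [-> //|/Sb]. Qed.

Lemma le_sup0 S T :
  (forall s, S s -> exists2 t, T t & s <= t) -> Defs.sup0 S <= Defs.sup0 T.
Proof.
move=> ST; apply: ge_sup0; first exact: sup0_ge0.
by move=> s /ST[t Tt st]; exact: le_trans st (sup0_ub Tt).
Qed.

End Sup0.

Lemma counting_card_le (R : realType) (T U : choiceType)
    (A : set T) (B : set U) :
  (A #<= B)%card -> counting A <= counting B :> \bar R.
Proof.
move=> AB; rewrite /counting.
case: (asboolP (finite_set B)) => [Bfin|_]; last by rewrite leey.
have Afin : finite_set A := card_le_finite AB Bfin.
rewrite asboolT// lee_fin ler_nat.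
have [m Bm] := Bfin; rewrite (card_fset_set Bm); apply: geq_card_fset_set.
by rewrite -(card_le_eqr Bm).
Qed.

Section Families.
Context {R : realType} {X : metricType R}.
Implicit Types (A B U : set X) (F G : set (set X)) (n : int) (f : X -> \bar R).

Lemma dist_set_subset x A B : A `<=` B -> dist_set x B <= dist_set x A.
Proof. by move=> AB; apply: ereal_inf_le_tmp; exact: image_subset. Qed.

Lemma dist_setP x A (r : \bar R) :
  r <= dist_set x A <-> forall a, A a -> r <= (mdist x a)%:E.
Proof.
split=> [/ereal_infP rA a Aa|rA]; first by apply: rA; exists a.
by apply/ereal_infP => _ [a Aa <-]; exact: rA.
Qed.

Lemma lebesgue_fun_gt0 F x :
  0 < lebesgue_fun setT F x -> exists2 U, F U & U x.
Proof.
move=> /ereal_sup_gt[_ [->|[U FU <-]]]; first by rewrite ltxx.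
move=> d0; exists U => //; apply: contrapT => nUx.
move: d0; rewrite ltNge => /negP; apply.
by apply: ereal_inf_lbound; exists x => //; rewrite mdistxx.
Qed.

(** In a smaller space there are fewer points outside [U], so the distance to
    them grows. *)
Lemma le_lebesgue_fun_restrict A F x :
  lebesgue_fun setT F x <= lebesgue_fun A (restrict_family F A) x.
Proof.
apply: le_sup0 => _ [U FU <-]; exists (dist_set x (A `\` (U `&` A))).
  by exists (U `&` A) => //; exists U.
by apply: dist_set_subset => a [Aa nU]; split=> // Ua; apply: nU.
Qed.

Lemma multiplicity_restrict A F :
  multiplicity A (restrict_family F A) <= multiplicity setT F.
Proof.
apply: le_sup0 => _ [x Ax <-]; exists (counting [set U | F U /\ U x]).
  by exists x.
apply: counting_card_le; apply: card_le_trans (card_image_le (setI^~ A) _).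
by apply: subset_card_le => _ [[U FU <-] [Ux _]]; exists U.
Qed.

Lemma lebesgue_dim_restrict n F A :
  lebesgue_dim n (restrict_family F A) A = lebesgue_dim n F A.
Proof.
rewrite /lebesgue_dim; have -> // : restrict_family (restrict_family F A) A
  = restrict_family F A.
rewrite /restrict_family image_comp; apply: eq_imagel => U _ /=.
by rewrite -setIA setIid.
Qed.

Lemma le_lebesgue_dim n F G A (t : \bar R) : 0 <= t ->
    refines G F -> multiplicity setT G <= (n + 1)%:~R%:E ->
    (forall x, A x -> t <= lebesgue_fun setT G x) ->
  t <= lebesgue_dim n F A.
Proof.
move=> t0 GF Gn tG; apply: sup0_ub; split=> //.
exists (restrict_family G A); split.
- move=> _ [V /GF[U FU VU] <-]; exists (U `&` A); first by exists U.
  exact: setSI.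
- exact: le_trans (multiplicity_restrict A G) Gn.
- apply/ereal_infP => _ [x Ax <-].
  exact: le_trans (tG x Ax) (le_lebesgue_fun_restrict A G x).
Qed.

Lemma lebesgue_dim_subspace n F A :
  lebesgue_dim n F setT <= lebesgue_dim n F A.
Proof.
apply: ge_sup0; first exact: sup0_ge0.
move=> t [t0 [G [GF Gn /ereal_infP tG]]].
apply: (@le_lebesgue_dim n F G) => // [V /GF[_ [U FU <-] VU]|x _].
  by exists U => //; rewrite setIT in VU.
by apply: tG; exists x.
Qed.

(** Sequential divergence is uniform: otherwise points at distance at least [k]
    from [x0] with small values of [f] form a sequence to infinity. *)
Lemma coarsely_proper_ge f (x0 : X) (M : R) : coarsely_proper f ->
  exists r : R, forall x, (r <= mdist x x0)%R -> M%:E <= f x.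
Proof.
move=> fP; apply: contrapT => /forallNP noR.
have /choice[u uP] : forall k : nat,
    exists x, (k%:R <= mdist x x0)%R /\ ~ M%:E <= f x.
  move=> k; have /existsNP[x /not_implyP[kx nfx]] := noR k%:R%R.
  by exists x.
have /fP/cvgeyPge/(_ M)[N _ /(_ N (leqnn N))] : to_infty u.
  exists x0; apply/cvgeyPge => r; near=> k; rewrite lee_fin.
  apply: le_trans (proj1 (uP k)); near: k; exact: nbhs_infty_ger.
exact: (proj2 (uP N)).
Unshelve. all: by end_near. Qed.

Lemma coarsely_proper_near f (A : nat -> set X) x0 (M : R) :
    coarsely_proper f -> dist_set x0 (A k) @[k --> \oo] --> +oo ->
  \forall k \near \oo, forall x, A k x -> M%:E <= f x.
Proof.
move=> fP /cvgeyPge Aoo; have [r rP] := coarsely_proper_ge x0 M fP.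
have := Aoo r; apply: filterS => k /dist_setP rA x Akx.
by apply: rP; rewrite metric_sym -lee_fin; exact: rA.
Qed.

(** An extension to the whole space of the trace of [F] on [A] whose members
    are as large as possible. *)
Definition fill F A : set (set X) := [set U `|` ~` A | U in F].

Lemma restrict_fill F A : restrict_family (fill F A) A = restrict_family F A.
Proof.
rewrite /restrict_family /fill image_comp; apply: eq_imagel => U _ /=.
by rewrite setIUl setICl setU0.
Qed.

Lemma dist_fill x A U :
  dist_set x (setT `\` (U `|` ~` A)) =
  dist_set x (A `\` U).
Proof. by congr dist_set; rewrite !setTD setCU setCK setIC. Qed.

(** Points are split according to their distance to [x0]: beyond [r] the
    coarseness of [F] suffices, within [r] the points are at distance at least
    [M] from [A k] as soon as the latter is at distance at least [r + M] from
    [x0]. *)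
Lemma fill_lebesgue_near F (A : nat -> set X) x0 (M : R) :
    coarse F -> (forall k, A k !=set0) ->
    dist_set x0 (A k) @[k --> \oo] --> +oo ->
  \forall k \near \oo, forall x, M%:E <= lebesgue_fun setT (fill F (A k)) x.
Proof.
move=> Fc A0 Aoo; have [r rP] := coarsely_proper_ge x0 M Fc.
have Anear := coarsely_proper_near 1 Fc Aoo.
have /cvgeyPge/(_ (r + M)%R) Afar := Aoo.
near=> k => x; have [rx|xr] := leP r (mdist x x0).
  apply: le_trans (rP x rx) _; apply: le_sup0 => _ [U FU <-].
  exists (dist_set x (A k `\` U)); last by apply: dist_set_subset => a [].
  by exists (U `|` ~` A k); [exists U|rewrite dist_fill].
(* A member of [F] is needed here: with no member, the function of [F] would
   vanish, whereas it is at least 1 on the nonempty [A k]. *)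
have [U FU] : F !=set0.
  have [a Aka] := A0 k; have : 1%:E <= lebesgue_fun setT F a.
    by move: a Aka; near: k; exact: Anear.
  by move=> /(lt_le_trans lte01)/lebesgue_fun_gt0[U FU _]; exists U.
apply: (@le_trans _ _ (dist_set x (A k `\` U))); last first.
  by apply: sup0_ub; exists (U `|` ~` A k); [exists U|rewrite dist_fill].
apply/dist_setP => a [Aka _]; rewrite lee_fin.
have : (r + M)%:E <= dist_set x0 (A k) by near: k; exact: Afar.
move=> /dist_setP/(_ a Aka); rewrite lee_fin => rMa.
have := metric_triangle x0 x a; rewrite (metric_sym x0 x) => x0a.
rewrite -(lerD2l r); apply: le_trans rMa (le_trans x0a _).
by rewrite lerD2r ltW.
Unshelve. all: by end_near. Qed.

End Families.

Section Comparison.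
Context {R : realType} (X : metricType R).

Lemma large_scale_le_coarse : large_scale_dim X <= coarse_dim X.
Proof.
apply: ereal_inf_le_tmp; apply: image_subset => n [n1 coarseP]; split=> //.
move=> F Ffin Fc A x0 A0 Aoo; have [G [GF Gc Gn]] := coarseP F Ffin Fc.
apply/cvgeyPge => M; have := coarsely_proper_near `|M| Gc Aoo.
apply: filterS => k MG; apply: (@le_trans _ _ `|M|%:E).
  by rewrite lee_fin ler_norm.
by apply: le_lebesgue_dim GF Gn MG; rewrite lee_fin.
Qed.

Lemma large_scale_le_minor : large_scale_dim X <= minor_asdim X.
Proof.
apply: ereal_inf_le_tmp; apply: image_subset => n [n0 adP]; split.
  exact: le_trans n0.
move=> F Ffin Fc A x0 A0 Aoo.
have fillP (M : R) := fill_lebesgue_near M Fc (fun k => (A0 k).1) Aoo.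
(* The extensions are only known to be covers from the index [N] on. *)
have [N _ coverP] := fillP 1%R.
pose H k := fill F (A (k + N)%N).
have Hcover k : finite_set (H k) /\ covers (H k).
  split; first exact: finite_image.
  apply/seteqP; split=> // x _.
  have /(lt_le_trans lte01)/lebesgue_fun_gt0[U HU Ux] :=
    coverP _ (leq_addl k N) x.
  by exists U.
have Hoo : lebesgue_number setT (H k) @[k --> \oo] --> +oo.
  rewrite (cvg_shiftn N (fun k => lebesgue_number setT (fill F (A k)))).
  apply/cvgeyPge => M; have := fillP M; apply: filterS => k MF.
  by apply/ereal_infP => _ [x _ <-]; exact: MF.
have := adP H Hcover Hoo.
rewrite (cvg_shiftn N (fun k => lebesgue_dim n (fill F (A k)) setT)).
move=> /cvgeyPge dimoo; apply/cvgeyPge => M.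
have := dimoo M; apply: filterS => k /le_trans; apply.
apply: le_trans (lebesgue_dim_subspace _ _ (A k)) _.
by rewrite -lebesgue_dim_restrict restrict_fill lebesgue_dim_restrict.
Qed.

End Comparison.

Theorem proposition6p2 (R : realType) (X : metricType R) :
  minor_asdim X >= large_scale_dim X /\ coarse_dim X >= large_scale_dim X.
Proof. by split; [exact: large_scale_le_minor|exact: large_scale_le_coarse]. Qed.
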